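(* Let $f:\mathbb{R}^n\to\mathbb{R}_+\cup\{+\infty\}$ and $g:\mathbb{R}^m\to\mathbb{R}_+\cup\{+\infty\}$ be closed proper convex nonnegative functions, $A:\mathbb{R}^n\to\mathbb{R}^m$ linear, $b\in\mathbb{R}^m$, and $\sigma>\inf_ug(u)$. Let $\nu_p$ and $\nu_d$ denote, respectively, the optimal values of the problems $$(N_p)\quad\text{minimize}_x\ f(x)\ \text{ subject to }\ g(b-Ax)\le\sigma,$$ $$(N_d)\quad\text{minimize}_{y,\alpha,\mu}\ f^\sharp(A^Ty,\alpha)\ \text{ subject to }\ \langle b,y\rangle-\sigma g^\sharp(y,\mu)\ge1-(\alpha+\mu).$$ Then: (a) (Basic inequalities) It is always the case that (i) $1/\nu_p\le\nu_d$ and (ii) $1/\nu_d\le\nu_p$. Thus $\nu_p=0$ implies that $(N_d)$ is infeasible, and $\nu_d=0$ implies that $(N_p)$ is infeasible. (b) (Weak duality) If $x$ and $(y,\alpha,\mu)$ are primal and dual feasible, then $1\le\nu_p\nu_d\le f(x)\cdot f^\sharp(A^Ty,\alpha)$. (c) (Strong duality) If the dual (resp. primal) is feasible and the primal (resp. dual) is relatively strictly feasible, then $\nu_p\nu_d=1$ and the perspective dual $(N_d)$ (resp. the primal $(N_p)$) attains its optimal value.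
   Context: The (closed) perspective of a closed proper convex function $h$ is $h^\pi(x,\lambda)=\lambda h(\lambda^{-1}x)$ if $\lambda>0$, $h^\pi(x,0)=h^\infty(x)$ (the recession function), $h^\pi(x,\lambda)=+\infty$ if $\lambda<0$. The polar of a gauge (nonnegative positively homogeneous convex function vanishing at $0$) $\kappa$ is $\kappa^\circ(y)=\inf\{\mu>0\mid\langle x,y\rangle\le\mu\kappa(x)\ \forall x\}$, with $\inf\emptyset=+\infty$. For nonnegative $h$, the perspective-polar transform is $h^\sharp=(h^\pi)^\circ$; equivalently $h^\sharp(z,-\xi)=\inf\{\mu>0\mid\langle z,x\rangle\le\xi+\mu h(x)\ \forall x\}$. Conventions: optimal values of infeasible problems are $+\infty$; $1/0=+\infty$, $1/(+\infty)=0$. $\operatorname{dom}h=\{h<+\infty\}$. Set $\mathcal{F}_p=\{u\mid g(b-u)\le\sigma\}$ and $\mathcal{F}_d=\{(y,\alpha,\mu)\in\mathbb{R}^m\times\mathbb{R}\times\mathbb{R}\mid\langle b,y\rangle-\sigma g^\sharp(y,\mu)\ge1-(\alpha+\mu)\}$. A point $x$ is primal feasible if $x\in\operatorname{dom}f$ and $Ax\in\mathcal{F}_p$; a triple $(y,\alpha,\mu)$ is dual feasible if $(A^Ty,\alpha)\in\operatorname{dom}f^\sharp$ and $(y,\alpha,\mu)\in\mathcal{F}_d$; a problem is feasible if it has a feasible point. $(N_p)$ is relatively strictly feasible if $A^{-1}(\operatorname{ri}\mathcal{F}_p)\cap\operatorname{ri}\operatorname{dom}f\ne\emptyset$; $(N_d)$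 is relatively strictly feasible if there is $(y,\alpha,\mu)\in\operatorname{ri}\mathcal{F}_d$ with $(A^Ty,\alpha)\in\operatorname{ri}\operatorname{dom}f^\sharp$. *)

(* Defs.v *)
From HB Require Import structures.
From mathcomp Require Import all_boot all_order all_algebra.
From mathcomp Require Import all_classical all_reals all_analysis.

Set Implicit Arguments.
Unset Strict Implicit.
Unset Printing Implicit Defensive.

Import Order.TTheory GRing.Theory Num.Theory.
Import numFieldNormedType.Exports.

Local Open Scope classical_set_scope.
Local Open Scope ring_scope.

Section ConvexSets.
Context {R : realType} {V : normedModType R}.
Implicit Types C : set V.

Definition affine_hull C : set V :=
  [set x | exists (k : nat) (c : 'I_k -> R) (v : 'I_k -> V),
    [/\ forall i, C (v i), \sum_(i < k) c i = 1
      & x = \sum_(i < k) c i *: v i]].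

Definition relint C : set V :=
  [set x | affine_hull C x /\ \forall y \near x, affine_hull C y -> C y].

Definition recession_cone C : set V :=
  [set d | forall x, C x -> forall t : R, 0 <= t -> C (x + t *: d)].

End ConvexSets.

Section ExtendedFunctions.
Context {R : realType}.

Definition edom {T : Type} (h : T -> \bar R) : set T :=
  [set x | (h x < +oo)%E].

Context {V : normedModType R}.
Implicit Types h : V -> \bar R.

Definition epigraph h : set (V * R^o)%type :=
  [set p | (h p.1 <= (p.2 : R)%:E)%E].

Definition proper_function h : Prop :=
  (exists x, (h x < +oo)%E) /\ (forall x, (-oo < h x)%E).

Definition closed_proper_convex h : Prop :=
  [/\ closed (epigraph h), proper_function h & convex_set (epigraph h)].

(* The function whose epigraph is the recession cone of the epigraph of h
   (Rockafellar, Convex Analysis, Section 8). *)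
Definition recession_function h : V -> \bar R :=
  fun d => ereal_inf [set (r : R)%:E | r in
                       [set r : R | recession_cone (epigraph h) (d, r : R^o)]].

Definition perspective h : (V * R^o)%type -> \bar R :=
  fun p => let lambda : R := p.2 in
    if 0 < lambda then (lambda%:E * h (lambda^-1 *: p.1))%E
    else if lambda == 0 then recession_function h p.1
    else +oo%E.

End ExtendedFunctions.

Section Polars.
Context {R : realType}.

Definition dotv {n : nat} (x y : 'cV[R]_n) : R :=
  \sum_(i < n) x i ord0 * y i ord0.

Definition dotp {n : nat} (p q : ('cV[R]_n * R^o)%type) : R :=
  dotv p.1 q.1 + (p.2 : R) * (q.2 : R).

(* Since mu > 0, the library product mu * +oo is +oo, so points outside the
   domain of k impose no constraint; ereal_inf set0 = +oo. *)
Definition polar {E : Type} (ip : E -> E -> R) (k : E -> \bar R) : E -> \bar R :=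
  fun y => ereal_inf [set (mu : R)%:E | mu in
    [set mu : R | 0 < mu /\ forall x, ((ip x y)%:E <= mu%:E * k x)%E]].

Definition sharp {n : nat} (h : 'cV[R]_n -> \bar R) :
    ('cV[R]_n * R^o)%type -> \bar R :=
  polar dotp (perspective h).

End Polars.

Section PerspectiveDuality.
Context {R : realType} {n m : nat}.
Variables (f : 'cV[R]_n -> \bar R) (g : 'cV[R]_m -> \bar R).
Variables (A : 'M[R]_(m, n)) (b : 'cV[R]_m) (sigma : R).

Definition Fp : set 'cV[R]_m := [set u | (g (b - u) <= sigma%:E)%E].

(* Triples (y, alpha, mu) are left-nested pairs. *)
Definition Fd : set ('cV[R]_m * R^o * R^o)%type :=
  [set w | let: (y, alpha, mu) := w in
    ((1 - ((alpha : R) + (mu : R)))%:E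
       <= (dotv b y)%:E - sigma%:E * sharp g (y, mu))%E].

Definition dual_arg (w : ('cV[R]_m * R^o * R^o)%type) : ('cV[R]_n * R^o)%type :=
  (A^T *m w.1.1, w.1.2).

Definition primal_feasible (x : 'cV[R]_n) : Prop :=
  edom f x /\ Fp (A *m x).

Definition dual_feasible (w : ('cV[R]_m * R^o * R^o)%type) : Prop :=
  edom (sharp f) (dual_arg w) /\ Fd w.

Definition nu_p : \bar R :=
  ereal_inf [set f x | x in [set x | Fp (A *m x)]].

Definition nu_d : \bar R :=
  ereal_inf [set sharp f (dual_arg w) | w in Fd].

Definition primal_rel_strictly_feasible : Prop :=
  exists x, relint Fp (A *m x) /\ relint (edom f) x.

Definition dual_rel_strictly_feasible : Prop :=
  exists w, relint Fd w /\ relint (edom (sharp f)) (dual_arg w).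

Definition primal_attained : Prop :=
  exists x, primal_feasible x /\ f x = nu_p.

Definition dual_attained : Prop :=
  exists w, dual_feasible w /\ sharp f (dual_arg w) = nu_d.

End PerspectiveDuality.

(* Main.v *)
Require Import Defs.
From HB Require Import structures.
From mathcomp Require Import all_boot all_order all_algebra.
From mathcomp Require Import all_classical all_reals all_analysis.
From mathcomp Require Import ring lra.

Set Implicit Arguments.
Unset Strict Implicit.
Unset Printing Implicit Defensive.

Import Order.TTheory GRing.Theory Num.Theory.
Import numFieldNormedType.Exports.

Local Open Scope classical_set_scope.
Local Open Scope ring_scope.

(* Membership [h# (y, xi) <= r] just says [<x, y> + xi <= r h(x)] for all [x],
   so adding the inequalities for [f] at [x] and for [g] at [b - A x] gives
   [1 <= f(x) f#(A^T y, alpha)] for feasible points; everything in (a) and (b)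
   follows.
   For (c), Fenchel-Rockafellar duality under the relative interior condition
   gives a multiplier [y] for the coupling [A x = u]. In the primal case, a
   Slater multiplier [rho] for [g <= sigma] completes [y] to a dual feasible
   point which, divided by [nu_p], has value at most [1 / nu_p]. In the dual
   case the multiplier is a pair [(x, t)] with [t >= nu_d], and positive
   homogeneity together with the bipolar theorem shows that [x / t] is primal
   feasible with value at most [1 / t].
   Only one consequence of relative interiority is used: segments of the set
   ending at the point can be prolonged beyond it. With it, separation is pure
   linear algebra, extending a minorant one coordinate at a time. *)

(** * Convex sets and one-dimensional extension of minorants *)

Section AlgebraicSeparation.
Context {R : realType}.

Lemma convex_setP (V : lmodType R) (C : set V) :
  convex_set C <-> forall x y (a b : R), 0 < a -> 0 < b -> a + b = 1 ->
    C x -> C y -> C (a *: x + b *: y).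
Proof.
split=> [cC x y a b a0 b0 ab Cx Cy|cC].
  have a01 : 0 <= a <= 1 by lra.
  have := cC x y (Itv01 (proj1 (andP a01)) (proj2 (andP a01))).
  rewrite !inE => /(_ Cx Cy).
  by rewrite (_ : b = 1 - a) //; lra.
apply/convex_setW => x y; rewrite !inE => Cx Cy k k0 k1; rewrite inE.
by apply: cC => //; rewrite ?subr_gt0 // addrC subrK.
Qed.

Lemma exists_between (A B : set R) :
  A !=set0 -> B !=set0 -> (forall a b, A a -> B b -> a <= b) ->
  exists c, (forall a, A a -> a <= c) /\ (forall b, B b -> c <= b).
Proof.
move=> A0 [b0 Bb0] AB; exists (sup A); split=> [a Aa|b Bb].
  by apply: ub_le_sup => //; exists b0 => a' Aa'; exact: AB.
by apply: ge_sup => // a Aa; exact: AB.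
Qed.

(** A negative slope would make the value [a - |a| - 1] at a suitable [t]. This is how additive
    constants are discarded later, when an inequality survives scaling or raising a point. *)
Lemma affine_ray_ge0 (a b : R) : (forall t, 0 <= t -> 0 <= a + t * b) -> 0 <= b.
Proof.
move=> h; rewrite leNgt; apply/negP => b0.
have t0 : 0 <= (`|a| + 1) / - b 
  by apply: divr_ge0; [exact: addr_ge0 | rewrite oppr_ge0 ltW].
have := h _ t0.
have -> : a + (`|a| + 1) / - b * b = a - `|a| - 1.
  by rewrite invrN mulrN mulNr divfK ?lt_eqF //; lra.
have := ler_norm a; lra.
Qed.

(** For nonempty convex [K] in finite dimension, this is the algebraic form of the origin being in
    the relative interior of the projection of [K] to [V]. *)
Definition opposite_reach (V : lmodType R) (K : set (V * R^o)) :=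
  forall w r, K (w, r) -> exists e s, 0 < e /\ K (- e *: w, s).

(* One step of the Hahn-Banach extension: the constraints on [t] coming from
   the two sides of the hyperplane [c = 0] are compatible because a convex
   combination of two points of [K] lies on that hyperplane. *)
Lemma extend_minorant (V : lmodType R) (K : set (V * R^o))
    (phi c : {linear V -> R^o}) :
  convex_set K -> opposite_reach K ->
  (forall w r, K (w, r) -> c w = 0 -> 0 <= r + phi w) ->
  exists t : R, forall w r, K (w, r) -> 0 <= r + (phi w + t * c w).
Proof.
move=> /convex_setP Kc Ko K0.
have [[w0 [r0 [Kw0 cw0]]]|none] :=
    pselect (exists w r, K (w, r) /\ 0 < c w); last first.
  (* If [c] is never positive on [K], opposite points show that it is never negative either, so all
     of [K] lies on [c = 0]. *)
  exists 0 => w r Kwr; rewrite mul0r addr0; apply: K0 (Kwr) _.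
  apply/eqP; rewrite eq_le !leNgt; apply/andP; split; apply/negP => cw.
    by apply: none; exists w, r.
  have [e [s [e0 Kes]]] := Ko _ _ Kwr; apply: none.
  exists (- e *: w), s; split=> //.
  by rewrite linearZ /= /GRing.scale /= mulNr -mulrN mulr_gt0 // oppr_gt0.
pose L := [set t : R | exists w r, [/\ K (w, r), 0 < c w
  & t = - (r + phi w) / c w]].
pose U := [set t : R | exists w r, [/\ K (w, r), c w < 0
  & t = (r + phi w) / - c w]].
have [t [Lt Ut]] : exists t, (forall a, L a -> a <= t) /\
    (forall b, U b -> t <= b).
  apply: exists_between.
  - by exists (- (r0 + phi w0) / c w0), w0, r0.
  - have [e [s [e0 Kes]]] := Ko _ _ Kw0.
    exists ((s + phi (- e *: w0)) / - c (- e *: w0)), (- e *: w0), s.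
    split=> //.
    by rewrite linearZ /= /GRing.scale /= mulNr oppr_lt0 mulr_gt0.
  move=> _ _ [w [r [Kw cw ->]]] [v [s [Kv cv ->]]].
  pose d := c w - c v; have d0 : 0 < d by rewrite /d; lra.
  have dN0 : d != 0 by rewrite gt_eqF.
  have := Kc _ _ (- c v / d) (c w / d) _ _ _ Kw Kv.
  rewrite !divr_gt0 ?oppr_gt0 // => /(_ isT isT) K1.
  have /K1/K0 : - c v / d + c w / d = 1 by rewrite -mulrDl addrC divff.
  rewrite !linearD !linearZ /= /GRing.scale /= => K2.
  have {}K2 : 0 <= ((r + phi w) * (- c v) + (s + phi v) * c w) / d.
    have -> : ((r + phi w) * - c v + (s + phi v) * c w) / d =
      - c v / d * r + c w / d * s + (- c v / d * phi w + c w / d * phi v).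
      by field.
    by apply: K2; field.
  rewrite ler_pdivrMr // mulrAC ler_pdivlMr ?oppr_gt0 //.
  have := K2; rewrite pmulr_lge0 ?invr_gt0 //; lra.
exists t => w r Kw; case: (ltrgtP (c w) 0) => cw.
- have := Ut _ (ex_intro _ w (ex_intro _ r (And3 Kw cw erefl))).
  rewrite ler_pdivlMr ?oppr_gt0 //; lra.
- have := Lt _ (ex_intro _ w (ex_intro _ r (And3 Kw cw erefl))).
  rewrite ler_pdivrMr //; lra.
- by rewrite cw mulr0 addr0; exact: K0.
Qed.

End AlgebraicSeparation.

(** * Inner products and separation in coordinates *)

Section Dot.
Context {R : realType}.

Lemma dotvC n (x y : 'cV[R]_n) : dotv x y = dotv y x.
Proof. by apply: eq_bigr => i _; rewrite mulrC. Qed.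

Lemma dotv_is_linear n (y : 'cV[R]_n) : linear_for *%R (dotv y : _ -> R^o).
Proof.
move=> a u v; rewrite /dotv mulr_sumr -big_split /=.
by apply: eq_bigr => i _; rewrite !mxE; ring.
Qed.

HB.instance Definition _ n (y : 'cV[R]_n) :=
  GRing.isLinear.Build R 'cV[R]_n R^o *%R (dotv y) (dotv_is_linear y).

Lemma dotvDr n (x y z : 'cV[R]_n) : dotv x (y + z) = dotv x y + dotv x z.
Proof. exact: raddfD. Qed.

Lemma dotvNr n (x y : 'cV[R]_n) : dotv x (- y) = - dotv x y.
Proof. exact: raddfN. Qed.

Lemma dotvBr n (x y z : 'cV[R]_n) : dotv x (y - z) = dotv x y - dotv x z.
Proof. exact: raddfB. Qed.

Lemma dotvZr n a (x y : 'cV[R]_n) : dotv x (a *: y) = a * dotv x y.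
Proof. exact: linearZ. Qed.

Lemma dotv0r n (x : 'cV[R]_n) : dotv x 0 = 0.
Proof. exact: raddf0. Qed.

Lemma dotvDl n (x y z : 'cV[R]_n) : dotv (y + z) x = dotv y x + dotv z x.
Proof. by rewrite !(dotvC _ x) dotvDr. Qed.

Lemma dotvBl n (x y z : 'cV[R]_n) : dotv (y - z) x = dotv y x - dotv z x.
Proof. by rewrite !(dotvC _ x) dotvBr. Qed.

Lemma dotvZl n a (x y : 'cV[R]_n) : dotv (a *: y) x = a * dotv y x.
Proof. by rewrite !(dotvC _ x) dotvZr. Qed.

Lemma dotv_delta n i (w : 'cV[R]_n) : dotv (delta_mx i ord0) w = w i ord0.
Proof.
rewrite /dotv (bigD1 i) //= mxE !eqxx mul1r big1 ?addr0 // => j ji.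
by rewrite mxE (negbTE ji) mul0r.
Qed.

Lemma dotv_trmx n m (A : 'M[R]_(m, n)) (y : 'cV[R]_m) (x : 'cV[R]_n) :
  dotv (A^T *m y) x = dotv y (A *m x).
Proof.
have dotvE k (u v : 'cV[R]_k) : dotv u v = (u^T *m v) ord0 ord0.
  by rewrite mxE; apply: eq_bigr => i _; rewrite mxE.
by rewrite !dotvE trmx_mul trmxK mulmxA.
Qed.

(** Read [K] as points above a convex function: [y] gives a non-vertical hyperplane through the
    origin lying below [K]. Abstracting the pairing serves both [dotv] and [dotp]. *)
Definition separable (W : lmodType R) (ip : W -> W -> R) :=
  forall K : set (W * R^o), convex_set K -> opposite_reach K ->
    (forall r, K (0, r) -> 0 <= r) ->
  exists y, forall w r, K (w, r) -> 0 <= r + ip y w.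

(** Induction on the number [j] of leading coordinates allowed to be nonzero; each step extends the
    functional along one more unit vector. *)
Lemma separable_dotv n : separable (@dotv R n).
Proof.
move=> K /convex_setP Kc Ko K0.
suff /(_ n)[y Hy] : forall j, exists y, forall w r, K (w, r) ->
    (forall i : 'I_n, (j <= i)%N -> w i ord0 = 0) -> 0 <= r + dotv y w.
  by exists y => w r /Hy; apply=> i; rewrite leqNgt ltn_ord.
elim=> [|j [y IH]].
  exists 0 => w r Kwr w0.
  have w00 : w = 0 by apply/colP => i; rewrite w0 // mxE.
  by rewrite w00 dotv0r addr0 K0 // -w00.
have [jn|nj] := ltnP j n; last first.
  exists y => w r Kwr _; apply: IH Kwr _ => i ji.
  by have := leq_trans nj ji; rewrite leqNgt ltn_ord.
pose KK : set ('cV[R]_n * R^o) :=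
  [set p | K p /\ forall i : 'I_n, (j < i)%N -> p.1 i ord0 = 0].
have [t Ht] : exists t : R, forall w r, KK (w, r) ->
    0 <= r + (dotv y w + t * dotv (delta_mx (Ordinal jn) ord0) w).
  apply: extend_minorant.
  - apply/convex_setP => u v a b a0 b0 ab [Ku u0] [Kv v0]; split.
      exact: Kc.
    by move=> i ji /=; rewrite !mxE u0 // v0 // !mulr0 addr0.
  - move=> w r [/Ko [e [s [e0 Ks]]] w0]; exists e, s; split=> //; split=> //.
    by move=> i ji /=; rewrite mxE w0 // mulr0.
  - move=> w r [Kw w0]; rewrite /= dotv_delta => wj.
    apply: IH Kw _ => i; rewrite leq_eqVlt => /orP[/eqP ji|/w0 //].
    by rewrite -[RHS]wj; congr (w _ _); apply/val_inj.
exists (y + t *: delta_mx (Ordinal jn) ord0) => w r Kw w0.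
by rewrite dotvDl dotvZl; exact: Ht.
Qed.

(** The slice with zero last coordinate gives the vector part; one more extension gives the scalar
    part. *)
Lemma separable_dotp n : separable (@dotp R n).
Proof.
move=> K /convex_setP Kc Ko K0.
have [y Hy] : exists y, forall w r, K ((w, 0), r) -> 0 <= r + dotv y w.
  apply: (separable_dotv (K := [set p | K ((p.1, 0), p.2)])) => //=.
  - apply/convex_setP => -[u r] [v s] a b a0 b0 ab Ku Kv.
    have := Kc _ _ _ _ a0 b0 ab Ku Kv.
    rewrite -[_ + b *: _]/(_, _); congr (K (_, _)); congr (_, _) => /=.
    by rewrite !scaler0 addr0.
  - move=> w r /Ko [e [s [e0 Ks]]]; exists e, s; split=> //.
    by move: Ks; congr (K (_, _)); congr (_, _); rewrite scaler0.
have [t Ht] : exists t : R, forall w r, K (w, r) ->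
    0 <= r + (dotv y w.1 + t * w.2).
  apply: (extend_minorant (phi := (dotv y : _ -> R^o) \o fst) (c := snd)).
  - exact/convex_setP.
  - exact: Ko.
  - by move=> [w s] r /= Kw s0; apply: Hy; rewrite -s0.
by exists (y, t).
Qed.

End Dot.

(** * Strict separation and Fenchel-Rockafellar duality *)

Section Separation.
Context {R : realType}.

Lemma strict_separation (V : normedModType R) (ip : V -> V -> R) (C : set V)
    (z : V) : separable ip -> closed C -> convex_set C -> ~ C z ->
  exists y (d : R), 0 < d /\ forall c, C c -> d <= ip y (c - z).
Proof.
move=> sep Ccl /convex_setP Cc Cz.
have [d /= d0 Hd] : exists2 d : R, 0 < d & forall c, C c -> d <= `|c - z|.
  have : nbhs z (~` C).
    by apply: open_nbhs_nbhs; split=> //; exact: closed_openC.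
  move=> /nbhs_ballP [d /= d0 Hd]; exists d => // c Cc'.
  rewrite leNgt; apply/negP => cz; apply: (Hd c) Cc'.
  by rewrite -ball_normE /= distrC.
(* Inf-convolving the indicator of [C - z] with the norm makes the domain the
   whole space, so no relative interior condition is needed. *)
pose K : set (V * R^o) :=
  [set p | exists2 c, C c & `|c - z - p.1| <= (p.2 : R) + d].
have [|||y Hy] := sep K.
- apply/convex_setP => -[u r] [v s] a b a0 b0 ab [c Cc1 /= cu] [e Ce /= ev].
  exists (a *: c + b *: e); first exact: Cc.
  rewrite /= (_ : _ - _ = a *: (c - z - u) + b *: (e - z - v)).
    apply: le_trans (ler_normD _ _) _; rewrite !normrZ !gtr0_norm //.
    rewrite /GRing.scale /=; nra.
  by rewrite !scalerBr addrACA -opprD addrACA -opprD -scalerDl ab scale1r.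
- move=> w r [c Cc1 /= cw]; exists 1, (`|c - z + w| - d); split=> //.
  by exists c => //=; rewrite subrK scaleN1r opprK.
- move=> r [c /Hd cz /=]; rewrite subr0 => h.
  by have := le_trans cz h; rewrite lerDr.
(* At [w = c - z] the norm vanishes, so [K] reaches down to height [- d] there. *)
exists y, d; split=> // c Cc'.
have := Hy (c - z) (- d); rewrite -lerBlDl sub0r opprK; apply.
by exists c => //=; rewrite subrr normr0 addNr.
Qed.

Lemma relint_extend (V : normedModType R) (C : set V) (x y : V) :
  relint C x -> C y -> \forall e \near 0^'+, C (x + e *: (x - y)).
Proof.
move=> [[k [c [v [Cv c1 ->]]]] nC] Cy; set x0 := \sum_(i < k) _ in nC *.
have : (fun e : R => x0 + e *: (x0 - y)) @ 0^'+ --> x0 + (0 : R) *: (x0 - y).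
  apply: cvg_at_right_filter; apply: (@cvgD _ _ _ _ _ (fun=> x0)).
    exact: cvg_cst.
  by apply: cvgZr_tmp; exact: cvg_id.
rewrite scale0r addr0 => cv.
have : \forall e \near (0 : R)^'+,
    affine_hull C (x0 + e *: (x0 - y)) -> C (x0 + e *: (x0 - y)) := cv _ nC.
apply: filterS => e; apply.
(* The prolonged point is the affine combination with weight [- e] on [y] and [1 + e] spread over
   the combination giving [x0]. *)
exists k.+1, (fun i => oapp (fun j => (1 + e) * c j) (- e) (unlift ord0 i)).
exists (fun i => oapp v y (unlift ord0 i)); split.
- by move=> i; case: (unlift ord0 i) => [j|] //=.
- rewrite big_ord_recl unlift_none /=.
  under eq_bigr do rewrite liftK /=.
  by rewrite -mulr_sumr c1; ring.
- rewrite big_ord_recl unlift_none /=.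
  under [in RHS]eq_bigr do rewrite liftK /= -scalerA.
  rewrite -scaler_sumr -/x0 scalerDl scale1r scalerBr scaleNr.
  by rewrite addrA [RHS]addrC.
Qed.

Lemma relint_sub (V : normedModType R) (C : set V) : relint C `<=` C.
Proof. by move=> x [aCx /nbhs_singleton]; apply. Qed.

(** Separation is applied to the residuals [L2 d - L1 x] paired with heights measured from [nu]: the
    bound on coupled points says that residual zero has no negative height. *)
Lemma fenchel_rockafellar (W V1 V2 : lmodType R) (ip : W -> W -> R)
    (L1 : {linear V1 -> W}) (L2 : {linear V2 -> W})
    (E : set (V1 * R^o)) (D : set V2) (x0 : V1) (d0 : V2) (nu : R) :
  separable ip -> convex_set E -> convex_set D ->
  (forall x r, E (x, r) ->
     \forall e \near 0^'+, exists s, E (x0 + e *: (x0 - x), s)) ->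
  (forall d, D d -> \forall e \near 0^'+, D (d0 + e *: (d0 - d))) ->
  L1 x0 = L2 d0 ->
  (forall x r d, E (x, r) -> D d -> L1 x = L2 d -> nu <= r) ->
  exists y, forall x r d, E (x, r) -> D d -> nu <= r + ip y (L2 d - L1 x).
Proof.
move=> sep /convex_setP Ec /convex_setP Dc x0E d0D xd hnu.
pose K : set (W * R^o) := [set p | exists x d,
  [/\ E (x, (p.2 : R) + nu), D d & p.1 = L2 d - L1 x]].
have [|||y Hy] := sep K.
- apply/convex_setP => -[u r] [v s] a b a0 b0 ab /=.
  move=> [x [d [Ex Dd /= eu]]] [x' [d' [Ex' Dd' /= ev]]].
  exists (a *: x + b *: x'), (a *: d + b *: d'); split.
  + have := Ec _ _ _ _ a0 b0 ab Ex Ex'.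
    rewrite (_ : a *: (x, _) + _ = (a *: x + b *: x', a * r + b * s + nu)) //.
    congr (_, _); rewrite /= /GRing.scale /=.
    by rewrite -[nu in RHS]mul1r -ab; ring.
  + exact: Dc.
  + rewrite /= eu ev !(linearD L1, linearD L2) !linearZ /= !scalerBr.
    by rewrite opprD addrACA.
- move=> w r [x [d [Ex Dd /= ->]]].
  (* Prolonging both segments by the same [e] turns the residual [w] into [- e *: w], because [x0]
     and [d0] are coupled. *)
  near (0 : R)^'+ => e.
  have [s Es] : exists s, E (x0 + e *: (x0 - x), s) by near: e; exact: x0E Ex.
  exists e, (s - nu); split; first by near: e; exact: nbhs_right_gt.
  exists (x0 + e *: (x0 - x)), (d0 + e *: (d0 - d)); split => /=.
  + by rewrite subrK.
  + by near: e; exact: d0D.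
  + rewrite /= (linearD L1) (linearD L2) !linearZ (linearB L1).
    rewrite (linearB L2) /= xd.
    rewrite opprD addrACA subrr add0r -scalerBr.
    suff -> : L2 d0 - L2 d - (L2 d0 - L1 x) = - (L2 d - L1 x).
      by rewrite scalerN scaleNr.
    by rewrite !opprB addrC subrKA.
- move=> r [x [d [Ex Dd /esym/eqP]]]; rewrite subr_eq0 => /eqP /esym.
  by move/(hnu _ _ _ Ex Dd); rewrite lerDr.
exists y => x r d Ex Dd.
have := Hy (L2 d - L1 x) (r - nu); rewrite addrAC subr_ge0; apply.
by exists x, d; rewrite /= subrK.
Unshelve. all: end_near. Qed.

End Separation.

(** * The perspective-polar transform and its bipolar *)

Section Sharp.
Context {R : realType}.

Lemma ler_mul_inf (c s r : R) :
  0 <= s -> (forall t, r < t -> c <= t * s) -> c <= r * s.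
Proof.
rewrite le_eqVlt => /predU1P[<- h|s0 h].
  by rewrite mulr0; have := h (r + 1); rewrite mulr0 ltrDl ltr01; apply.
rewrite -ler_pdivrMr //; apply/ler_addgt0Pr => e e0.
by rewrite ler_pdivrMr // h // ltrDl.
Qed.

Lemma edom_le T (h : T -> \bar R) x :
  (0 <= h x)%E -> edom h x -> exists s : R, (h x <= s%:E)%E.
Proof.
by move=> h0 hx; exists (fine (h x)); rewrite fineK // ge0_fin_numE.
Qed.

Context {n : nat} {h : 'cV[R]_n -> \bar R}.
Hypotheses (h_ge0 : forall x, (0 <= h x)%E) (h_dom : edom h !=set0).

Lemma sharp_ge0 p : (0 <= sharp h p)%E.
Proof. by apply/ereal_infP => _ [mu [/ltW mu0 _] <-]; rewrite lee_fin. Qed.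

(** Only [lambda = 1] carries information: [lambda > 0] rescales it, [lambda = 0] is its limit along
    rays of the epigraph, and [lambda < 0] gives [+oo]. The bound at [r] itself, even [r = 0], is
    the limit of those at [mu > r]. *)
Lemma sharp_leP p (r : R) : (sharp h p <= r%:E)%E <->
  0 <= r /\ forall x (s : R), (h x <= s%:E)%E -> dotv x p.1 + p.2 <= r * s.
Proof.
case: p => y xi /=; split=> [hr|[r0 hr]].
  split=> [|x s hs]; first by rewrite -lee_fin (le_trans (sharp_ge0 _) hr).
  have s0 : 0 <= s by rewrite -lee_fin (le_trans (h_ge0 x) hs).
  apply: ler_mul_inf => // t rt.
  have /ereal_inf_ltP[_ [mu [mu0 /(_ (x, 1)) Hmu] <-] mut] :
    (sharp h (y, xi) < t%:E)%E by apply: le_lt_trans hr _; rewrite lte_fin.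
  move: Hmu; rewrite /perspective /= ltr01 invr1 scale1r mul1e /dotp /= mul1r.
  move=> Hmu; rewrite -lee_fin; apply: le_trans Hmu _.
  rewrite EFinM; apply: le_trans (lee_wpmul2l _ hs) _; first exact: ltW.
  by rewrite -EFinM lee_fin ler_wpM2r // -lee_fin ltW.
apply/lee_addgt0Pr => e e0; rewrite -EFinD; set mu := r + e.
have mu0 : 0 < mu by rewrite /mu; lra.
have {}hr x s : (h x <= s%:E)%E -> dotv x y + xi <= mu * s.
  move=> hs; have s0 : 0 <= s by rewrite -lee_fin (le_trans (h_ge0 x) hs).
  by apply: le_trans (hr _ _ hs) _; rewrite ler_wpM2r // /mu; lra.
apply: ereal_inf_lbound; exists mu => //; split=> // -[x l].
rewrite /dotp /perspective /=; case: ifPn => [l0|l0].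
  have [hy|hfin] := eqVneq (h (l^-1 *: x)) +oo%E.
    by rewrite hy gt0_muley // gt0_muley // leey.
  have [s hs] : exists s : R, (h (l^-1 *: x) = s%:E)%E.
    by exists (fine (h (l^-1 *: x))); rewrite fineK // ge0_fin_numE // ltey.
  have := hr (l^-1 *: x) s; rewrite hs lexx dotvZl => /(_ isT).
  rewrite -!EFinM lee_fin => H; have := ler_wpM2l (ltW l0) H.
  by rewrite mulrDr mulVKf ?gt_eqF // [X in _ <= X]mulrCA.
case: eqP => [->|_]; last by rewrite gt0_muley // leey.
rewrite mul0r addr0.
have [x0 hx0] := h_dom; have [s0 hs0] := edom_le (h_ge0 x0) hx0.
(* The epigraph contains the ray from [(x0, s0)] along [(x, r')]; the inequality all along it
   constrains the slope. *)
have : ((dotv x y / mu)%:E <= recession_function h x)%E.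
  apply/ereal_infP => _ [r' Hr <-].
  rewrite lee_fin ler_pdivrMr // mulrC -subr_ge0.
  apply: (affine_ray_ge0 (a := mu * s0 - dotv x0 y - xi)) => t t0.
  have := hr _ _ (Hr (x0, s0) hs0 t t0); rewrite /= dotvDl dotvZl.
  rewrite /GRing.scale /=; nra.
move/(lee_wpmul2l (ltW mu0 : (0 <= mu%:E)%E)); rewrite -EFinM.
by rewrite mulrC divfK ?gt_eqF.
Qed.

Lemma convex_epigraph_sharp : convex_set (epigraph (sharp h)).
Proof.
apply/convex_setP => -[p r] [q s] a b a0 b0 ab /sharp_leP[/= r0 Hr].
move=> /sharp_leP[/= s0 Hs]; apply/sharp_leP => /=.
split=> [|x t hx].
  by apply: addr_ge0; apply: mulr_ge0 => //; exact: ltW.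
rewrite dotvDr !dotvZr /GRing.scale /=.
have := Hr x t hx; have := Hs x t hx; nra.
Qed.

Lemma sharp_scale t p r : 0 <= t -> (sharp h p <= r%:E)%E ->
  (sharp h (t *: p)%R <= (t * r)%:E)%E.
Proof.
move=> t0 /sharp_leP[r0 Hr]; apply/sharp_leP; split; first exact: mulr_ge0.
move=> x s hs; rewrite dotvZr /= /GRing.scale /= -mulrDr -mulrA.
by apply: ler_wpM2l => //; exact: Hr.
Qed.

Lemma sharp0_le : (sharp h (0 : ('cV[R]_n * R^o)%type)%R <= 0%R%:E)%E.
Proof.
by apply/sharp_leP; split=> // x s _; rewrite /= dotv0r addr0 mul0r.
Qed.

(* The value at [v] of the bipolar of the perspective; nonnegativity of [h]
   makes the vertical hyperplanes (zero last coordinate) harmless. *)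
Lemma sharp_bipolar v (s : R) : closed_proper_convex h ->
  (forall p (r : R), (sharp h p <= r%:E)%E -> dotv v p.1 + p.2 <= s * r) ->
  (h v <= s%:E)%E.
Proof.
move=> [hcl _ hcv] H; apply: contrapT => hv.
have [[y be] [d [d0 Hd]]] :=
  strict_separation (z := (v, s : R^o)) (@separable_dotp R n) hcl hcv hv.
have {}Hd u (r : R) : (h u <= r%:E)%E ->
    d <= dotv y u - dotv y v + be * (r - s).
  by move=> hu; have := Hd (u, r) hu; rewrite /dotp /= dotvBr.
(* The epigraph is unbounded upwards, so the vertical coefficient cannot be negative. *)
have be0 : 0 <= be.
  have [x0 hx0] := h_dom; have [s0 hs0] := edom_le (h_ge0 x0) hx0.
  apply: (affine_ray_ge0 (a := dotv y x0 - dotv y v + be * (s0 - s) - d)).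
  move=> t t0; have : (h x0 <= (s0 + t)%:E)%E.
    by apply: le_trans hs0 _; rewrite lee_fin lerDl.
  by move/Hd; lra.
(* The hyperplane itself is a test point of the hypothesis, which then yields [d <= 0]. *)
have : (sharp h (- y, d + dotv y v + be * s)%R <= be%:E)%E.
  apply/sharp_leP; split=> // x r /Hd /=.
  by rewrite dotvNr (dotvC x); lra.
by move/H => /=; rewrite dotvNr (dotvC v); lra.
Qed.

End Sharp.

(** * A Lagrange multiplier for the level constraint *)

Section Slater.
Context {R : realType} {m : nat} {g : 'cV[R]_m -> \bar R}.

Lemma slater_multiplier (y : 'cV[R]_m) (sigma c : R) :
  convex_set (epigraph g) -> (ereal_inf (range g) < sigma%:E)%E ->
  (forall v, (0 <= g v)%E) ->
  (forall v, (g v <= sigma%:E)%E -> dotv y v <= c) ->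
  exists2 rho : R, 0 <= rho & forall v (s : R), (g v <= s%:E)%E ->
    dotv y v - c <= rho * (s - sigma).
Proof.
move=> /convex_setP gc /ereal_inf_ltP[_ [v0 _ <-] gv0] g0 Hc.
have [s0 /= gs0 s0s] : exists2 s0 : R, (g v0 <= s0%:E)%E & s0 < sigma.
  have gf : g v0 \is a fin_num by rewrite ge0_fin_numE // (lt_trans gv0) ?ltey.
  by exists (fine (g v0)); rewrite -?lte_fin fineK.
(* First coordinate: excess of the level over [sigma]; second: slack in [dotv y v <= c]. The
   multiplier is the slope of a line below this planar set. *)
pose K : set (R^o * R^o) :=
  [set p | exists2 v, (g v <= ((p.1 : R) + sigma)%:E)%E & p.2 = c - dotv y v].
have [rho Hrho] : exists t : R, forall w r, K (w, r) -> 0 <= r + (0 + t * w).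
  apply: (extend_minorant (phi := \0) (c := idfun)).
  - apply/convex_setP => -[w r] [z s] a b a0 b0 ab [u /= gu ->] [v /= gv ->].
    exists (a *: u + b *: v).
      have := gc _ _ _ _ a0 b0 ab (gu : epigraph g (u, _))
        (gv : epigraph g (v, _)).
      rewrite /epigraph /= /GRing.scale /=; congr (_ <= _%:E)%E.
      by rewrite -[sigma in RHS]mul1r -ab; ring.
    rewrite /= dotvDr !dotvZr /GRing.scale /=.
    by rewrite -[c in RHS]mul1r -ab; ring.
  (* A positive excess is opposed by the Slater point [v0], whose excess is at most
     [s0 - sigma < 0]; otherwise raising the level at the same [v] suffices. *)
  - move=> w r [v /= gv _]; have [w0|w0] := ltP 0 w.
      exists ((sigma - s0) / w), (c - dotv y v0).
      split; first by rewrite divr_gt0 // subr_gt0.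
      exists v0 => //=; rewrite /GRing.scale /= mulNr divfK ?gt_eqF //.
      by rewrite opprB subrK.
    exists 1, (c - dotv y v); split=> //; exists v => //=.
    apply: le_trans gv _; rewrite lee_fin scaleN1r lerD2r.
    by move: (w : R) w0 => z z0; lra.
  - move=> w r [v /= gv ->] w0; rewrite addr0 subr_ge0; apply: Hc.
    by rewrite -[sigma]add0r -w0.
have {}Hrho v (s : R) : (g v <= s%:E)%E -> dotv y v - c <= rho * (s - sigma).
  move=> gv; have : K (s - sigma, c - dotv y v).
    by exists v => //=; rewrite subrK.
  by move/Hrho; rewrite add0r; lra.
exists rho => //.
(* Raising the level above [v0] indefinitely forces [rho >= 0]. *)
apply: (affine_ray_ge0 (a := rho * (s0 - sigma) - (dotv y v0 - c))) => t t0.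
have /Hrho : (g v0 <= (s0 + t)%:E)%E.
  by apply: le_trans gs0 _; rewrite lee_fin lerDl.
by lra.
Qed.

End Slater.

(** * Products and reciprocals of infima *)

Section ReciprocalValues.
Context {R : realType}.

(** Neither infimum need be attained: a real strictly above it dominates a member of the set, and
    [ler_mul_inf] closes the gap for each factor in turn. *)
Lemma inf_mul_ge1 (P D : set \bar R) (s t : R) :
  (forall p, P p -> 0 <= p)%E -> (forall d, D d -> 0 <= d)%E ->
  (forall p d s t, P p -> D d -> (p <= s%:E)%E -> (d <= t%:E)%E -> 1 <= s * t) ->
  (ereal_inf P <= s%:E)%E -> (ereal_inf D <= t%:E)%E -> 1 <= s * t.
Proof.
move=> P0 D0 PD Ps Dt.
have t0 : 0 <= t.
  by rewrite -lee_fin; apply: le_trans Dt; apply/ereal_infP.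
apply: ler_mul_inf => // s' ss'.
have /ereal_inf_ltP[p Pp /ltW ps'] : (ereal_inf P < s'%:E)%E.
  by apply: le_lt_trans Ps _; rewrite lte_fin.
have s'0 : 0 <= s' by rewrite -lee_fin (le_trans (P0 _ Pp)).
rewrite mulrC; apply: ler_mul_inf => // t' tt'; rewrite mulrC.
have /ereal_inf_ltP[d Dd /ltW dt'] : (ereal_inf D < t'%:E)%E.
  by apply: le_lt_trans Dt _; rewrite lte_fin.
exact: PD Pp Dd ps' dt'.
Qed.

Lemma inve_le_mul_ge1 (p d : \bar R) : (0 <= p)%E -> (0 <= d)%E ->
  (forall s t, (p <= s%:E)%E -> (d <= t%:E)%E -> 1 <= s * t) -> (p^-1 <= d)%E.
Proof.
case: p => [s| |] // s0; case: d => [t| |] // t0 h; last by rewrite leey.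
have {}h : 1 <= s * t by apply: h.
have sp : 0 < s.
  rewrite lt_neqAle -lee_fin s0 andbT; apply/eqP => s00.
  by move: h; rewrite -s00; lra.
by rewrite inver gt_eqF // lee_fin -[s^-1]mul1r ler_pdivrMr // mulrC.
Qed.

End ReciprocalValues.

(** * Weak duality and the two multiplier theorems *)

Section Duality.
Context {R : realType} {n m : nat}.
Variables (f : 'cV[R]_n -> \bar R) (g : 'cV[R]_m -> \bar R).
Variables (A : 'M[R]_(m, n)) (b : 'cV[R]_m) (sigma : R).
Hypotheses (hf : closed_proper_convex f) (f_ge0 : forall x, (0 <= f x)%E).
Hypotheses (hg : closed_proper_convex g) (g_ge0 : forall u, (0 <= g u)%E).
Hypothesis hsigma : (ereal_inf (range g) < sigma%:E)%E.

Let f_dom : edom f !=set0. Proof. by case: hf => _ [[x fx] _] _; exists x. Qed.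
Let g_dom : edom g !=set0. Proof. by case: hg => _ [[x gx] _] _; exists x. Qed.

Let sigma_gt0 : 0 < sigma.
Proof.
rewrite -lte_fin; apply: le_lt_trans hsigma; apply/ereal_infP => _ [u _ <-].
exact: g_ge0.
Qed.

(** Since [sigma > 0], an infinite [sharp g] would make the right-hand side of the constraint [-oo];
    hence a real bound [rho] always exists. *)
Lemma FdP y (alpha mu : R) : Fd g b sigma (y, alpha, mu) <-> exists rho : R,
  (sharp g (y, mu) <= rho%:E)%E /\ 1 - (alpha + mu) <= dotv b y - sigma * rho.
Proof.
rewrite /Fd /=; split=> [|[rho [Hrho Hy]]].
  have := @sharp_ge0 _ _ g (y, mu).
  case: (sharp g (y, mu)) => [rho _ Hy||] //.
    by exists rho; split=> //; move: Hy; rewrite -EFinM -EFinB lee_fin.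
  by rewrite gt0_muley ?lte_fin // addeNy leeNy_eq.
apply: (@le_trans _ _ ((dotv b y)%:E - sigma%:E * rho%:E)%E).
  by rewrite -EFinM -EFinB lee_fin.
by apply: leeB => //; apply: lee_wpmul2l => //; rewrite lee_fin ltW.
Qed.

Lemma weak_duality x w (s t : R) :
  Fp g b sigma (A *m x) -> (f x <= s%:E)%E -> Fd g b sigma w ->
  (sharp f (dual_arg A w) <= t%:E)%E -> 1 <= s * t.
Proof.
move: w => [[y alpha] mu] Fx fs /FdP[rho [/(sharp_leP g_ge0 g_dom)[_ Hg] Hy]].
move=> /(sharp_leP f_ge0 f_dom)[_ /(_ _ _ fs)] /=.
have := Hg _ _ Fx; rewrite /= dotvBl (dotvC x) dotv_trmx (dotvC (A *m x)).
by lra.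
Qed.

Lemma dual_arg_is_linear : linear (dual_arg (R := R) A).
Proof.
by move=> a [[y al] mu] [[z be] nu]; rewrite /dual_arg /= mulmxDr -scalemxAr.
Qed.

HB.instance Definition _ := GRing.isLinear.Build R
  ('cV[R]_m * R^o * R^o)%type ('cV[R]_n * R^o)%type *:%R
  (dual_arg (R := R) A) dual_arg_is_linear.

Lemma convex_Fp : convex_set (Fp g b sigma).
Proof.
case: hg => _ _ /convex_setP gc; apply/convex_setP => u v c d c0 d0 cd gu gv.
rewrite /Fp /= (_ : b - _ = c *: (b - u) + d *: (b - v)); last first.
  by rewrite !scalerBr addrACA -opprD -scalerDl cd scale1r.
rewrite -[sigma]mul1r -cd mulrDl.
exact: (gc (_, _) (_, _) _ _ c0 d0 cd (gu : epigraph g (_, _))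
  (gv : epigraph g (_, _))).
Qed.

Lemma convex_Fd : convex_set (Fd g b sigma).
Proof.
have /convex_setP gc := convex_epigraph_sharp g_ge0 g_dom.
apply/convex_setP => -[[y al] mu] [[z be] nu] c d c0 d0 cd.
move=> /FdP[r [Hr Hy]] /FdP[s [Hs Hz]].
apply/(FdP (c *: y + d *: z) (c * al + d * be) (c * mu + d * nu)).
exists (c * r + d * s); split; first exact: (gc ((y, mu), r) ((z, nu), s)).
rewrite dotvDr !dotvZr.
have := ler_wpM2l (ltW c0) Hy; have := ler_wpM2l (ltW d0) Hz; lra.
Qed.

(** The point found satisfies the dual constraint with [nu] in place of [1]; dividing by a positive
    [nu] normalises it. *)
Lemma primal_multiplier (nu : R) :
  primal_rel_strictly_feasible f g A b sigma ->
  (forall x (s : R), (f x <= s%:E)%E -> Fp g b sigma (A *m x) -> nu <= s) ->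
  exists y (alpha mu rho : R), [/\ (sharp g (y, mu) <= rho%:E)%E,
    nu - (alpha + mu) <= dotv b y - sigma * rho
    & (sharp f ((A^T *m y)%R, alpha) <= 1%:E)%E].
Proof.
move=> [x0 [Fx0 fx0]] Hnu.
have [y Hy] : exists y, forall x (r : R) u, epigraph f (x, r) ->
    Fp g b sigma u -> nu <= r + dotv y (u - A *m x).
  apply: (fenchel_rockafellar (L1 := mulmx A) (L2 := idfun) (x0 := x0)
    (d0 := A *m x0)) => //.
  - exact: separable_dotv.
  - by case: hf.
  - exact: convex_Fp.
  - move=> x r fxr; have fx : edom f x by apply: le_lt_trans fxr (ltey _).
    by apply: filterS (relint_extend fx0 fx) => e /(edom_le (f_ge0 _)).
  - by move=> d; exact: relint_extend.
  - by move=> x s u fxs + /= Ax; rewrite -Ax; exact: Hnu.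
(* The joint inequality in [x] and [u] is split at a constant [c] into one for [f] and one for the
   level set of [g]. *)
have [c [Hc1 Hc2]] : exists c,
    (forall a, [set a | exists x (r : R),
       (f x <= r%:E)%E /\ a = nu - r + dotv y (A *m x)] a -> a <= c) /\
    (forall a, [set a | exists2 u, Fp g b sigma u & a = dotv y u] a -> c <= a).
  apply: exists_between.
  - have fx0' := relint_sub fx0; have [s hs] := edom_le (f_ge0 x0) fx0'.
    by exists (nu - s + dotv y (A *m x0)), x0, s.
  - by exists (dotv y (A *m x0)), (A *m x0) => //; exact: relint_sub.
  - move=> _ _ [x [r [fxr ->]]] [u Fu ->].
    have := Hy x r u fxr Fu; rewrite dotvBr; lra.
have [rho rho0 Hrho] : exists2 rho : R, 0 <= rho & forall v (s : R),
    (g v <= s%:E)%E -> dotv y v - (dotv y b - c) <= rho * (s - sigma).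
  apply: slater_multiplier => //; first by case: hg.
  move=> v gv; have /Hc2 : [set a | exists2 u, Fp g b sigma u & a = dotv y u]
      (dotv y (b - v)).
    by exists (b - v) => //; rewrite /Fp /= subKr.
  by rewrite dotvBr; lra.
(* [alpha] and [mu] are the constant terms of the inequalities for [f] and [g]; with them the dual
   constraint holds with equality. *)
exists y, (nu - c), (rho * sigma - (dotv y b - c)), rho; split.
- apply/(sharp_leP g_ge0 g_dom); split=> // v s /Hrho /=.
  by rewrite (dotvC v); lra.
- by rewrite (dotvC b); lra.
- apply/(sharp_leP f_ge0 f_dom); split=> // x s fxs.
  rewrite /= (dotvC x) dotv_trmx.
  have := Hc1 _ (ex_intro _ x (ex_intro _ s (conj fxs erefl))); lra.
Qed.

Lemma dual_multiplier (nu : R) : 0 < nu ->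
  dual_rel_strictly_feasible f g A b sigma ->
  (forall w (r : R), Fd g b sigma w -> (sharp f (dual_arg A w) <= r%:E)%E ->
     nu <= r) ->
  exists x, (f x <= nu^-1%:E)%E /\ Fp g b sigma (A *m x).
Proof.
move=> nu0 [w0 [Fw0 fw0]] Hnu.
have [[x t] Hxt] : exists xt, forall p (r : R) w, epigraph (sharp f) (p, r) ->
    Fd g b sigma w -> nu <= r + dotp xt (dual_arg A w - p).
  apply: (fenchel_rockafellar (L1 := idfun) (L2 := dual_arg A)
    (x0 := dual_arg A w0) (d0 := w0)) => //.
  - exact: separable_dotp.
  - exact: convex_epigraph_sharp.
  - exact: convex_Fd.
  - move=> p r fpr.
    have fp : edom (sharp f) p by apply: le_lt_trans fpr (ltey _).
    by apply: filterS (relint_extend fw0 fp) => e /(edom_le (sharp_ge0 _)).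
  - by move=> d; exact: relint_extend.
  - by move=> p r w fpr Fw /= pw; apply: Hnu Fw _; rewrite -pw.
(* With [w0] fixed, [p] is scaled by arbitrary [s >= 0], leaving only the homogeneous part. *)
have Hf p (r : R) : (sharp f p <= r%:E)%E -> dotv x p.1 + t * p.2 <= r.
  move=> fpr; rewrite -subr_ge0.
  apply: (affine_ray_ge0 (a := dotp (x, t) (dual_arg A w0) - nu)) => s s0.
  have /Hxt/(_ (relint_sub Fw0)) := sharp_scale f_ge0 f_dom s0 fpr.
  by rewrite /dotp /= dotvBr dotvZr /GRing.scale /=; lra.
have f0 := sharp0_le f_ge0 f_dom.
have HFd y (al mu : R) : Fd g b sigma (y, al, mu) ->
    nu <= dotv (A *m x) y + t * al.
  move/(Hxt _ _ _ f0).
  by rewrite subr0 /dotp /= dotvC dotv_trmx (dotvC y) add0r.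
have nut : nu <= t.
  have /HFd : Fd g b sigma (0, 1, 0).
    apply/FdP; exists 0; split; first exact: (sharp0_le g_ge0 g_dom).
    by rewrite dotv0r; lra.
  by rewrite dotv0r; lra.
have t0 : 0 < t by exact: lt_le_trans nut.
have Hg y (mu rho : R) : (sharp g (y, mu) <= rho%:E)%E ->
    0 <= dotv (A *m x) y + t * (sigma * rho - mu - dotv b y).
  move=> gy; apply: (affine_ray_ge0 (a := t - nu)) => s s0.
  (* A ray in [Fd] starting at [(0, 1, 0)], with [alpha] chosen to make the constraint tight when
     [rho] stands for [sharp g]. *)
  have /HFd : Fd g b sigma
      (s *: y, 1 - s * mu - s * dotv b y + s * (sigma * rho), s * mu).
    apply/FdP; exists (s * rho); split; first exact: (sharp_scale _ _ s0 gy).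
    by rewrite dotvZr; lra.
  by rewrite dotvZr; lra.
have tN0 : t != 0 by rewrite gt_eqF.
(* Divided by [t], [Hf] and [Hg] become the bipolar criteria for [f] at this point with bound
   [t^-1], and for [g] at the residual with bound [sigma]. *)
exists (t^-1 *: x); split.
  apply: (@le_trans _ _ t^-1%:E); last by rewrite lee_fin lef_pV2.
  apply: (sharp_bipolar f_ge0 f_dom) => // p r /Hf Hp.
  by rewrite dotvZl ler_pdivlMl // mulrDr mulVKf.
apply: (sharp_bipolar g_ge0 g_dom) => // -[y mu] r /Hg Hy.
rewrite /= -scalemxAr dotvBl dotvZl -(ler_pM2l t0) mulrDr mulrBr mulVKf //.
by move: Hy; lra.
Qed.

End Duality.

(** * Attainment, and assembly of the three claims *)

Lemma inf_mul_attained (R : realType) (p d : R) (v : \bar R) :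
  0 < p -> 1 <= p * d -> (d%:E <= v)%E -> (v <= p^-1%:E)%E ->
  (p%:E * d%:E = 1)%E /\ v = d%:E.
Proof.
move=> p0 pd dv vp.
(* Everything is squeezed: [p^-1 <= d <= v <= p^-1]. *)
have dp : d = p^-1.
  apply/eqP; rewrite eq_le -lee_fin (le_trans dv vp) /=.
  by rewrite -[p^-1]mul1r ler_pdivrMr // mulrC.
split; first by rewrite dp -EFinM divff ?gt_eqF.
by apply/eqP; rewrite eq_le dv dp vp.
Qed.

Theorem theorem4p7 (R : realType) (n m : nat)
    (f : 'cV[R]_n -> \bar R) (g : 'cV[R]_m -> \bar R)
    (A : 'M[R]_(m, n)) (b : 'cV[R]_m) (sigma : R)
    (hf : closed_proper_convex f) (f_ge0 : forall x, (0 <= f x)%E)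
    (hg : closed_proper_convex g) (g_ge0 : forall u, (0 <= g u)%E)
    (hsigma : (ereal_inf (range g) < sigma%:E)%E) :
  let nup := nu_p f g A b sigma in
  let nud := nu_d f g A b sigma in
  (* (a) basic inequalities *)
  [/\ (nup^-1 <= nud)%E, (nud^-1 <= nup)%E,
      nup = 0%E -> ~ (exists w, dual_feasible f g A b sigma w)
    & nud = 0%E -> ~ (exists x, primal_feasible f g A b sigma x)]
  /\
  (* (b) weak duality *)
  (forall (x : 'cV[R]_n) (y : 'cV[R]_m) (alpha mu : R),
     primal_feasible f g A b sigma x ->
     dual_feasible f g A b sigma (y, alpha, mu) ->
     (1 <= nup * nud <= f x * sharp f (A^T *m y, alpha))%E)
  /\
  (* (c) strong duality *)
  ((exists w, dual_feasible f g A b sigma w) ->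
     primal_rel_strictly_feasible f g A b sigma ->
     (nup * nud = 1)%E /\ dual_attained f g A b sigma)
  /\
  ((exists x, primal_feasible f g A b sigma x) ->
     dual_rel_strictly_feasible f g A b sigma ->
     (nup * nud = 1)%E /\ primal_attained f g A b sigma).
Proof.
move=> nup nud.
have f_dom : edom f !=set0 by case: hf => _ [[x fx] _] _; exists x.
have g_dom : edom g !=set0 by case: hg => _ [[x gx] _] _; exists x.
have p_ge0 : (0 <= nup)%E by apply/ereal_infP => _ [x _ <-].
have d_ge0 : (0 <= nud)%E by apply/ereal_infP => _ [w _ <-]; exact: sharp_ge0.
have pd_ge1 s t : (nup <= s%:E)%E -> (nud <= t%:E)%E -> 1 <= s * t.
  apply: inf_mul_ge1 => [_ [x _ <-]|_ [w _ <-]|_ _ s' t' [x Fx <-] [w Fw <-]] //.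
    exact: sharp_ge0.
  by move=> fs ft; exact: (weak_duality hf f_ge0 hg g_ge0 hsigma Fx fs Fw ft).
have nup_le x : Fp g b sigma (A *m x) -> (nup <= f x)%E.
  by move=> Fx; apply: ereal_inf_lbound; exists x.
have nud_le w : Fd g b sigma w -> (nud <= sharp f (dual_arg A w))%E.
  by move=> Fw; apply: ereal_inf_lbound; exists w.
have p_ub x : primal_feasible f g A b sigma x -> exists s : R, (nup <= s%:E)%E.
  move=> [/(edom_le (f_ge0 x))[s fs] Fx]; exists s.
  exact: le_trans (nup_le _ Fx) fs.
have d_ub w : dual_feasible f g A b sigma w -> exists t : R, (nud <= t%:E)%E.
  move=> [/(edom_le (sharp_ge0 _))[t ft] Fw]; exists t.
  exact: le_trans (nud_le _ Fw) ft.
have pd_fin x w : primal_feasible f g A b sigma x ->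
    dual_feasible f g A b sigma w ->
    exists p d, [/\ nup = p%:E, nud = d%:E, 0 < p, 0 < d & 1 <= p * d].
  move=> /p_ub[s ps] /d_ub[t dt].
  have pf : nup \is a fin_num by rewrite ge0_fin_numE // (le_lt_trans ps) ?ltey.
  have df : nud \is a fin_num by rewrite ge0_fin_numE // (le_lt_trans dt) ?ltey.
  have := pd_ge1 (fine nup) (fine nud); rewrite !fineK // !lexx.
  move=> /(_ isT isT) pd; exists (fine nup), (fine nud); rewrite !fineK //.
  have p0 : 0 <= fine nup by exact: fine_ge0.
  have d0 : 0 <= fine nud by exact: fine_ge0.
  (* A zero value would make the product zero, against [1 <= p * d]. *)
  by split=> //; rewrite lt_neqAle ?p0 ?d0 andbT; apply/eqP => e;
    move: pd; rewrite -e; lra.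
split; [split|split; [|split]].
- exact: inve_le_mul_ge1.
- by apply: inve_le_mul_ge1 => // t s dt ps; rewrite mulrC; exact: pd_ge1.
- move=> p0 [w /d_ub[t dt]].
  by have := pd_ge1 0 t; rewrite p0 lexx mul0r => /(_ isT dt); lra.
- move=> d0 [x /p_ub[s ps]].
  by have := pd_ge1 s 0; rewrite d0 lexx mulr0 => /(_ ps isT); lra.
- move=> x y alpha mu px dw; have [p [d [ep ed _ _ pd]]] := pd_fin _ _ px dw.
  apply/andP; split; first by rewrite ep ed -EFinM lee_fin.
  by apply: lee_pmul => //; [exact: nup_le px.2 | exact: nud_le dw.2].
- move=> [w dw] str; have [x0 [/relint_sub Fx0 /relint_sub fx0]] := str.
  have [p [d [ep ed p0 d0 pd]]] := pd_fin x0 w (conj fx0 Fx0) dw.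
  have [|y [al [mu [rho [gy Fy fy]]]]] :=
      primal_multiplier hf f_ge0 hg g_ge0 hsigma (nu := p) str.
    by move=> x s fs Fx; rewrite -lee_fin -ep (le_trans (nup_le _ Fx)).
  (* Dividing the multiplier by the primal value [p] restores the constant [1] in the dual
     constraint and brings the value bound to [p^-1]. *)
  pose v : 'cV[R]_m * R^o * R^o := (p^-1 *: y, p^-1 * al, p^-1 * mu).
  have pV0 : 0 <= p^-1 by rewrite invr_ge0 ltW.
  have Fv : Fd g b sigma v.
    apply/(FdP _ g_ge0 hsigma); exists (p^-1 * rho).
    split; first exact: (sharp_scale g_ge0 g_dom pV0 gy).
    have := ler_wpM2l pV0 Fy; rewrite dotvZr mulrBr mulVf ?gt_eqF //; lra.
  have fv : (sharp f (dual_arg A v) <= p^-1%:E)%E.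
    have := sharp_scale f_ge0 f_dom pV0 fy.
    by rewrite mulr1 /dual_arg /= -scalemxAr.
  have [] := inf_mul_attained p0 pd _ fv; first by rewrite -ed; exact: nud_le.
  rewrite ep ed => -> efv; split=> //; exists v; split; last by rewrite efv -ed.
  by split=> //; rewrite /edom /= efv ltey.
- move=> [x px] str; have [w0 [/relint_sub Fw0 /relint_sub fw0]] := str.
  have [p [d [ep ed p0 d0 pd]]] := pd_fin x w0 px (conj fw0 Fw0).
  (* Here the multiplier is already normalised: its value is at most [d^-1]. *)
  have [|v [fv Fv]] := dual_multiplier hf f_ge0 hg g_ge0 hsigma d0 str.
    by move=> w r Fw fr; rewrite -lee_fin -ed (le_trans (nud_le _ Fw)).
  have dp : 1 <= d * p by rewrite mulrC.
  have [] := inf_mul_attained d0 dp _ fv; first by rewrite -ep; exact: nup_le.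
  rewrite ep ed muleC => -> efv; split=> //; exists v.
  by split; [split=> //; rewrite /edom /= efv ltey | rewrite efv -ep].
Qed.
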